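(* Let $r>0$ and let $\mathcal{F}$ be a finite family of axis-parallel rectangles in $\mathbb{R}^2$ that has an $r$-bounded aspect ratio. Then $\tau(\mathcal{F}) \leq (14+2r^2)\,\nu(\mathcal{F})$.
   Context: An axis-parallel rectangle in $\mathbb{R}^2$ is a set $F=[x_1,y_1]\times[x_2,y_2]$ with $x_i<y_i$; write $l_i(F)=y_i-x_i$ for $i=1,2$. The family $\mathcal{F}$ has an $r$-bounded aspect ratio if $l_i(F)/l_j(F)\le r$ for every $F\in\mathcal{F}$ and all $i,j\in\{1,2\}$. The matching number $\nu(\mathcal{F})$ is the maximum size of a subfamily of pairwise disjoint rectangles in $\mathcal{F}$, and the covering number $\tau(\mathcal{F})$ is the minimum size of a set of points in $\mathbb{R}^2$ that meets every rectangle in $\mathcal{F}$. *)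

(* Defs.v *)
From HB Require Import structures.
From mathcomp Require Import all_boot all_order all_algebra finmap.
From mathcomp Require Import boolp classical_sets reals.

Set Implicit Arguments.
Unset Strict Implicit.
Unset Printing Implicit Defensive.

Import Order.TTheory GRing.Theory Num.Theory.

Local Open Scope classical_set_scope.
Local Open Scope ring_scope.

Record rectangle (R : realType) := Rectangle {
  lower : 'rV[R]_2;
  upper : 'rV[R]_2;
  lower_lt_upper : forall i : 'I_2, lower 0 i < upper 0 i }.

Definition rectangle_set (R : realType) (A : rectangle R) : set 'rV[R]_2 :=
  [set p | forall i : 'I_2, lower A 0 i <= p 0 i <= upper A 0 i].

Definition side_length (R : realType) (i : 'I_2) (A : rectangle R) : R :=
  upper A 0 i - lower A 0 i.

Definition bounded_aspect_ratio (R : realType) (r : R) (I : finType)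
    (F : I -> rectangle R) : Prop :=
  forall (k : I) (i j : 'I_2), side_length i (F k) / side_length j (F k) <= r.

(* Repetitions in F are harmless: rectangles are nonempty, so a pairwise
   disjoint subfamily never uses the same rectangle twice. *)
Definition matching (R : realType) (I : finType) (F : I -> rectangle R)
    (S : {set I}) : Prop :=
  trivIset [set` S] (fun k => rectangle_set (F k)).

Definition matching_number (R : realType) (I : finType)
    (F : I -> rectangle R) : nat :=
  \max_(S : {set I} | `[< matching F S >]) #|S|.

Definition cover (R : realType) (I : finType) (F : I -> rectangle R)
    (P : {fset 'rV[R]_2}) : Prop :=
  forall k : I, exists2 p, p \in P & rectangle_set (F k) p.

Lemma cover_exists (R : realType) (I : finType) (F : I -> rectangle R) :
  exists n : nat, `[< exists2 P, cover F P & #|` P|%fset = n >].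
Proof.
pose P := [fset lower (F k) | k in I]%fset.
exists #|` P|%fset; apply/asboolP; exists P => // k.
exists (lower (F k)); first by apply/imfsetP; exists k.
by move=> i; rewrite lexx ltW ?lower_lt_upper.
Qed.

Definition covering_number (R : realType) (I : finType)
    (F : I -> rectangle R) : nat :=
  ex_minn (cover_exists F).

(* Main.v *)
Require Import Defs.
From mathcomp Require Import all_boot all_order all_algebra reals.
From mathcomp Require Import finmap boolp classical_sets lra.

(** The bound comes from a greedy argument, and in fact [2 * r + 4] would do as
    the constant.  Choose a rectangle [A] of the family with the shortest side
    [s] occurring in the family.  The other side of [A] is at most [r * s], so
    for any integer [n >= r] a grid of [2 * (n + 1)] points on [A], consisting
    of the end points of the short side times [n + 1] equidistant points on the
    long one, has steps at most [s] within the short side and within the long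
    one.  Every other rectangle has both sides at least [s]; if it meets [A],
    then in each coordinate its projection is an interval too long to fit
    strictly between two consecutive grid values, so it contains a grid point
    ([interval_meets_net], [grid_pierces]).

    Thus [2 * (n + 1)] points pierce all the rectangles that meet [A].  Put [A]
    into the matching, and repeat with the rectangles disjoint from [A]: each
    round costs [2 * (n + 1)] points and adds one rectangle to the matching
    ([greedy_matching_cover]).  With [n = floor r + 1] the number of points per
    round is at most [2 * r + 4 <= 14 + 2 * r ^+ 2]. *)

Set Implicit Arguments.
Unset Strict Implicit.
Unset Printing Implicit Defensive.

Import Order.TTheory GRing.Theory Num.Theory.

Local Open Scope ring_scope.

(** If [[c, d]] does not contain [b], then the last net point that does not
    exceed [d] has its successor beyond [d], hence is at least [c]. *)
Lemma interval_meets_net (R : realType) (a b c d : R) (m : nat) :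
  a < b -> (0 < m)%N -> b - a <= m%:R * (d - c) -> a <= d -> c <= b ->
  exists j : 'I_m.+1, c <= a + j%:R * ((b - a) / m%:R) <= d.
Proof.
move=> ab m0 hm ad cb; have m0R : 0 < m%:R :> R by rewrite ltr0n.
set h := (b - a) / m%:R.
have h0 : 0 < h by rewrite divr_gt0 // subr_gt0.
have hdc : h <= d - c by rewrite ler_pdivrMr // mulrC.
have mh : m%:R * h = b - a by rewrite mulrC divfK // gt_eqF.
have [bd|db] := leP b d.
  by exists ord_max; rewrite /= mh addrC subrK cb bd.
have x0 : 0 <= (d - a) / h by rewrite divr_ge0 ?subr_ge0 // ltW.
have /andP[] := truncn_itv x0; set j := Num.truncn _.
rewrite ler_pdivlMr // ltr_pdivrMr // -natr1 mulrDl mul1r => jle jgt.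
have jm : (j < m.+1)%N.
  rewrite ltnS -(ler_nat R) -(ler_pM2r h0) mh; lra.
by exists (Ordinal jm) => /=; apply/andP; split; lra.
Qed.

Definition grid_point (R : realType) (A : rectangle R) (m : 'I_2 -> nat)
    (j : 'I_2 -> nat) : 'rV[R]_2 :=
  \row_i (lower A 0 i + (j i)%:R * (side_length i A / (m i)%:R)).

Definition grid (R : realType) (A : rectangle R) (m : 'I_2 -> nat) :
    {fset 'rV[R]_2} :=
  [fset grid_point A m (fun i => if i == 0 then val t.1 else val t.2)
    | t in {: 'I_(m 0%R).+1 * 'I_(m 1%R).+1}]%fset.

Lemma card_grid (R : realType) (A : rectangle R) (m : 'I_2 -> nat) :
  (#|` grid A m|%fset <= (m 0%R).+1 * (m 1%R).+1)%N.
Proof.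
apply: (leq_trans (leq_imfset_card _ _ _)).
by rewrite -cardE card_prod !card_ord.
Qed.

Lemma grid_pierces (R : realType) (A B : rectangle R) (m : 'I_2 -> nat) :
  (forall i, (0 < m i)%N) ->
  (forall i, side_length i A <= (m i)%:R * side_length i B) ->
  (rectangle_set A `&` rectangle_set B !=set0)%classic ->
  exists2 p, p \in grid A m & rectangle_set B p.
Proof.
move=> m0 mAB [q [qA qB]].
have ex i : exists j : 'I_(m i).+1,
    lower B 0 i <= lower A 0 i + j%:R * (side_length i A / (m i)%:R)
      <= upper B 0 i.
  have /andP[lA uA] := qA i; have /andP[lB uB] := qB i.
  apply: interval_meets_net; rewrite ?lower_lt_upper //.
  - exact: mAB.
  - exact: le_trans uB.
  - exact: le_trans uA.
have [j0 hj0] := ex 0; have [j1 hj1] := ex 1.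
exists (grid_point A m (fun i => if i == 0 then val j0 else val j1)).
  by apply/imfsetP; exists (j0, j1).
move=> i; rewrite mxE.
have [->|i0] := eqVneq i 0; first by [].
suff -> : i = 1 by [].
by apply/val_inj; case: i i0 => [[|[|]]].
Qed.

(** Take for [F k] the rectangle that has the shortest side in [S].  All sides
    of the other rectangles are at least as long, so a step no longer than that
    side makes the grid on [F k] fine enough for each of them, and the bound [r]
    on the aspect ratio limits how many such steps the other side of [F k]
    needs. *)
Lemma exists_locally_pierced (R : realType) (r : R) (I : finType)
    (F : I -> rectangle R) (n : nat) (S : {set I}) :
  bounded_aspect_ratio r F -> (0 < n)%N -> r <= n%:R -> S != finset.set0 ->
  exists2 k, k \in S & exists2 P : {fset 'rV[R]_2},
    (#|` P|%fset <= 2 * n.+1)%N &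
    forall l, l \in S ->
      (rectangle_set (F k) `&` rectangle_set (F l) !=set0)%classic ->
      exists2 p, p \in P & rectangle_set (F l) p.
Proof.
move=> Fr n0 rn /set0Pn[k0 k0S].
pose side (t : I * 'I_2) := side_length t.2 (F t.1).
have : (k0, 0) \in [pred t : I * 'I_2 | t.1 \in S] by [].
case/(arg_minP side) => -[k i0] /= kS kmin.
have side0 l i : 0 < side_length i (F l).
  by rewrite subr_gt0 lower_lt_upper.
(* One step spans the shortest side, and [n >= r] steps suffice for the other. *)
pose m i := if i == i0 then 1%N else n.
exists k => //; exists (grid (F k) m).
  apply: leq_trans (card_grid _ _) _; rewrite /m.
  by case: i0 {kmin m} => [[|[|//]] ?] /=; rewrite // mulnC.
move=> l lS; apply: grid_pierces => i; rewrite /m; first by case: ifP.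
have sil : side_length i0 (F k) <= side_length i (F l) := kmin (l, i) lS.
have [->|_] := eqVneq i i0; first by rewrite mul1r; exact: kmin (l, i0) lS.
have := Fr k i i0; rewrite ler_pdivrMr // => /le_trans; apply.
apply: ler_pM rn sil; last exact: ltW.
by apply: le_trans (Fr k i i); rewrite divr_ge0 // ltW.
Qed.

(** The chosen [k] joins the matching and pays for the points that pierce
    everything it meets, itself included.  What is left is disjoint from [F k],
    so a matching found there by induction stays one when [k] is added. *)
Lemma greedy_matching_cover (R : realType) (I : finType)
    (F : I -> rectangle R) (c : nat) :
  (forall S : {set I}, S != finset.set0 ->
    exists2 k, k \in S & exists2 P : {fset 'rV[R]_2},
      (#|` P|%fset <= c)%N &
      forall l, l \in S ->
        (rectangle_set (F k) `&` rectangle_set (F l) !=set0)%classic ->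
        exists2 p, p \in P & rectangle_set (F l) p) ->
  forall S : {set I}, exists T : {set I}, exists P : {fset 'rV[R]_2},
    [/\ T \subset S, matching F T, (#|` P|%fset <= c * #|T|)%N &
        forall l, l \in S -> exists2 p, p \in P & rectangle_set (F l) p].
Proof.
move=> pierce S.
elim: {S}#|S|.+1 {-2}S (ltnSn #|S|) => // N IH S; rewrite ltnS => SN.
have [->|S0] := eqVneq S finset.set0.
  exists finset.set0, fset0; split; rewrite ?sub0set ?cardfs0 //.
  - by move=> i j /=; rewrite inE.
  - by move=> l; rewrite inE.
have [k kS [P Pc Ppierce]] := pierce S S0.
pose meets l := `[< rectangle_set (F k) `&` rectangle_set (F l) !=set0 >]%classic.
have kk : meets k.
  apply/asboolP; exists (lower (F k)); split=> i;
    by rewrite lexx ltW ?lower_lt_upper.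
pose S' := [set l in S | ~~ meets l].
have [] := IH S'.
  apply: leq_trans SN; apply: proper_card; apply/properP; split.
    by apply/fintype.subsetP => l; rewrite inE => /andP[].
  by exists k => //; rewrite inE kk andbF.
move=> T [Q [TS' Tm Qc Qpierce]].
have TS l : l \in T -> l \in S /\ ~~ meets l.
  by move=> /(fintype.subsetP TS'); rewrite inE => /andP[].
have kT : k \notin T by apply/negP => /TS[_]; rewrite kk.
exists (k |: T), (P `|` Q)%fset; split.
- apply/fintype.subsetP => l; rewrite !inE => /orP[/eqP -> //|].
  by case/TS.
- move=> i j /= /setU1P[->|iT] /setU1P[->|jT] // ij.
  + by case/TS: jT => _ /asboolP[].
  + by case/TS: iT => _ /asboolP[]; rewrite setIC.
  + exact: Tm.
- rewrite cardsU1 kT mulnDr muln1 cardfsU.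
  by apply: leq_trans (leq_subr _ _) _; apply: leq_add.
- move=> l lS; case: (boolP (meets l)) => [/asboolP|] lk.
    have [p pP pl] := Ppierce l lS lk.
    by exists p; rewrite // in_fsetU pP.
  have [|p pQ pl] := Qpierce l; first by rewrite inE lS.
  by exists p; rewrite // in_fsetU pQ orbT.
Qed.

Lemma covering_number_le_matching_number (R : realType) (r : R) (I : finType)
    (F : I -> rectangle R) (n : nat) :
  bounded_aspect_ratio r F -> (0 < n)%N -> r <= n%:R ->
  (covering_number F <= 2 * n.+1 * matching_number F)%N.
Proof.
move=> Fr n0 rn.
have [|T [P [_ Tm Pc Pcover]]] :=
  @greedy_matching_cover R I F (2 * n.+1) _ finset.setT.
  by move=> S; exact: exists_locally_pierced Fr n0 rn.
apply: (@leq_trans #|` P|%fset).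
  rewrite /covering_number; case: ex_minnP => c _; apply.
  by apply/asboolP; exists P => // k; apply: Pcover; rewrite inE.
apply: (leq_trans Pc); rewrite leq_mul2l /=.
by apply: leq_bigmax_cond; apply/asboolP.
Qed.

Theorem theorem1p10 (R : realType) (r : R) (I : finType)
    (F : I -> rectangle R) :
  0 < r ->
  bounded_aspect_ratio r F ->
  (covering_number F)%:R <= (14 + 2 * r ^+ 2) * (matching_number F)%:R :> R.
Proof.
move=> r0 Fr; have /andP[nr rn] := truncn_itv (ltW r0).
have := covering_number_le_matching_number Fr (ltn0Sn _) (ltW rn).
rewrite -(ler_nat R) natrM => /le_trans; apply.
apply: ler_wpM2r; first exact: ler0n.
rewrite natrM -[in X in X <= _]natr1 -natr1.
(* With the truncation of [r] bounded by [r], it remains to compare [2 * r + 4]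
   with the constant, and 14 + 2 r^2 - (2 r + 4) = r^2 + (r - 1)^2 + 9. *)
have := sqr_ge0 r; have := sqr_ge0 (r - 1); rewrite !expr2; nra.
Qed.
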